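(* For every even integer $n \ge 16$, there exists a connected cubic (that is, $3$-regular) simple graph $G$ of order $n$ whose coalition number satisfies $C(G) = 9$.
   Context: All graphs are finite, undirected, simple and connected. The order of a graph is its number of vertices. For a graph $G=(V,E)$, a set $S \subseteq V$ is a dominating set if every vertex of $V \setminus S$ is adjacent to at least one vertex of $S$. A coalition in $G$ consists of two disjoint sets $V_1, V_2 \subset V$ such that neither $V_1$ nor $V_2$ is a dominating set of $G$, but the union $V_1 \cup V_2$ is a dominating set of $G$; one then says that $V_1$ forms a coalition with $V_2$. A coalition partition of a graph $G$ of order $n$ is a partition $\mathcal{P} = \{V_1, V_2, \dots, V_k\}$ of the vertex set $V$ (into nonempty sets) such that every set $V_i$ either is a dominating set consisting of a single vertex of degree $n-1$, or is not a dominating set but forms a coalition with another set $V_j \in \mathcal{P}$ that is not a dominating set. The coalition number $C(G)$ is the maximum cardinality $k$ of a coalition partition of $G$. *)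

(* Defs.v *)
From mathcomp Require Import all_boot.
Set Implicit Arguments. Unset Strict Implicit. Unset Printing Implicit Defensive.

(* A graph on the vertex type T is given by its adjacency relation e : rel T. *)

Section Graphs.
Variables (T : finType) (e : rel T).

Definition simple_graph : Prop := symmetric e /\ irreflexive e.

Definition connected_graph : Prop := 0 < #|T| /\ forall x y : T, connect e x y.

Definition degree (x : T) : nat := #|[set y | e x y]|.

Definition regular_graph (d : nat) : Prop := forall x : T, degree x = d.

Definition dominating (S : {set T}) : bool :=
  [forall x in ~: S, exists y in S, e x y].

Definition coalition (A B : {set T}) : bool :=
  [&& [disjoint A & B], ~~ dominating A, ~~ dominating B
    & dominating (A :|: B)].

Definition full_singleton (A : {set T}) : bool :=
  [exists v, (A == [set v]) && (degree v == #|T|.-1)].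

(* The library's [partition] requires the blocks to be nonempty. *)
Definition coalition_partition (P : {set {set T}}) : bool :=
  partition P [set: T] &&
  [forall A in P,
     (dominating A && full_singleton A)
     || (~~ dominating A && [exists B in P :\ A, coalition A B])].

(* The maximum of an empty family is 0; as a partition of a nonempty vertex set
   has at least one block, a positive value is always attained. *)
Definition coalition_number : nat :=
  \max_(P : {set {set T}} | coalition_partition P) #|P|.

End Graphs.

(* Main.v *)
Require Import Defs.
From mathcomp Require Import all_boot.
From mathcomp Require Import zify.
Set Implicit Arguments. Unset Strict Implicit. Unset Printing Implicit Defensive.

(* Upper bound: if x is not dominated by a block A, every coalition contains a
   block meeting the closed neighbourhood of x, which has 4 vertices.  So each
   vertex A of the graph of coalitions is missed by a vertex cover of size at
   most 4, and a graph without isolated vertices with this property has at most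
   9 vertices.

   Lower bound: colour the vertices by B_i, C_i, D_i (i < 3) so that each closed
   neighbourhood meets B_i or both C_i and D_i, for every i.  Then B_i u C_i and
   B_i u D_i dominate.  Explicit examples of orders 16 and 18, found by computer
   search, are extended 4 vertices at a time: an edge joining B_1 to B_2 is
   replaced by K_4 minus an edge, coloured so that no old vertex sees a change. *)

(** * Graphs in which every vertex is avoided by a small vertex cover *)

Section VertexCovers.
Variables (V : finType) (h : rel V) (P : {set V}).
Hypothesis h_sym : symmetric h.

Definition vertex_cover (K : {set V}) : bool :=
  (K \subset P) &&
  [forall x in P, forall y in P, h x y ==> (x \in K) || (y \in K)].

Lemma vertex_coverP K x y : vertex_cover K -> x \in P -> y \in P -> h x y ->
  (x \in K) || (y \in K).
Proof.
by case/andP=> _ /forall_inP/(_ x)+ xP yP hxy => /(_ xP)/forall_inP/(_ y yP)/implyP; apply.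
Qed.

Section AvoidingCover.
Variable X : {set V}.
Hypothesis X_cover : vertex_cover X.

Let O (i : V) := [set y in P :\: X | h i y].

(* A cover K missing i contains O i, and for every other l in I either l itself
   or the private neighbour of l; all these elements are distinct. *)
Lemma leq_card_avoiding_cover (I K : {set V}) (i : V) :
    I \subset X -> i \in I -> vertex_cover K -> i \notin K ->
    {in I, forall l, exists2 d, d \in O l & {in I, forall l', d \in O l' -> l' = l}} ->
  #|O i| + #|I| <= #|K :&: (I :|: (P :\: X))|.+1.
Proof.
move=> IX iI Kcov iK priv.
have XP : X \subset P by case/andP: X_cover.
(* [r l] is the element of [K] charged to [l]. For [l] in [I] the default of [odflt] is never
   reached, because [priv] supplies a private neighbour. *)
pose r l := if l \in K then l else
  odflt l [pick d in O l | [forall l' in I, (d \in O l') ==> (l' == l)]].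
have rP l : l \in I -> l != i -> r l \in K /\ 
   (r l = l \/ [/\ r l \in O l & {in I, forall l', r l \in O l' -> l' = l}]).
  move=> lI nli; rewrite /r; case: ifP => [lK|lK]; first by split; [|left].
  case: pickP => [d /andP[dO /forall_inP dI]|none] /=.
    have dI' : {in I, forall l', d \in O l' -> l' = l}.
      by move=> l' l'I dO'; apply/eqP; apply: (implyP (dI _ l'I)).
    split; last by right; split.
    have : h l d by move: dO; rewrite inE => /andP[].
    move=> /(vertex_coverP Kcov); rewrite lK /=; apply.
      exact: (subsetP XP _ (subsetP IX _ lI)).
    by move: dO; rewrite !inE => /andP[/andP[]].
  have [d dO dI] := priv l lI.
  have := none d; rewrite dO /= => /negP[]; apply/forall_inP => l' l'I.
  by apply/implyP => /(dI _ l'I) ->.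
have OnX l d : d \in O l -> d \notin X by rewrite !inE => /andP[/andP[]].
have OP l d : d \in O l -> d \in P by rewrite !inE => /andP[/andP[]].
have OiK : O i \subset K.
  apply/subsetP => d dO.
  have : h i d by move: dO; rewrite inE => /andP[].
  move=> /(vertex_coverP Kcov); rewrite (negPf iK) /=; apply; last exact: OP dO.
  exact: (subsetP XP _ (subsetP IX _ iI)).
have r_inj : {in I :\ i &, injective r}.
  move=> l1 l2 /setD1P[n1 l1I] /setD1P[n2 l2I] E.
  case: (rP _ l1I n1) => _ [E1|[O1 p1]]; case: (rP _ l2I n2) => _ [E2|[O2 p2]].
  - by rewrite -E1 -E2.
  - by move/OnX: O2; rewrite -E E1 (subsetP IX _ l1I).
  - by move/OnX: O1; rewrite E E2 (subsetP IX _ l2I).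
  - by rewrite (p1 l2) // E.
have dis : [disjoint O i & r @: (I :\ i)].
  rewrite disjoint_subset; apply/subsetP => d dO; rewrite inE /=.
  apply/imsetP => -[l /setD1P[nl lI] dE].
  case: (rP _ lI nl) => _ [E|[_ p]].
    by move/OnX: dO; rewrite dE E (subsetP IX _ lI).
  by move: nl; rewrite -(p i iI) ?eqxx // -dE.
have sub : O i :|: r @: (I :\ i) \subset K :&: (I :|: (P :\: X)).
  apply/subsetP => d /setUP[dO|/imsetP[l /setD1P[nl lI] ->]].
    by rewrite !inE (subsetP OiK) // (OnX _ _ dO) (OP _ _ dO) orbT.
  have [rK rE] := rP _ lI nl; rewrite inE rK /= inE.
  case: rE => [->|[rO _]]; first by rewrite lI.
  by rewrite inE (OnX _ _ rO) (OP _ _ rO) orbT.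
have := subset_leq_card sub.
rewrite cardsU (disjoint_setI0 dis) cards0 subn0 card_in_imset //.
by rewrite (cardsD1 i I) iI /=; lia.
Qed.

End AvoidingCover.

(** If [P] had 10 elements, at least 6 would lie outside a cover [X] of size at most 4. Let m
    elements of [X], minimal under inclusion, have neighbourhoods covering the outside. Each such
    neighbourhood has at most 5 - m elements there, so 6 <= m(5 - m). This forces m = 2 or 3 with
    equality throughout, and an element of [X] not among these m breaks the equality. *)
Lemma card_le9_of_small_covers :
    {in P, forall x, exists2 y, y \in P & h x y} ->
    {in P, forall x, exists2 K, vertex_cover K & (x \notin K) && (#|K| <= 4)} ->
  #|P| <= 9.
Proof.
move=> nbr cov; rewrite leqNgt; apply/negP => P10.
have [a aP] : exists a, a \in P by apply/card_gt0P; lia.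
have [X Xcov /andP[_ X4]] := cov a aP.
have XP : X \subset P by case/andP: Xcov.
pose O (i : V) := [set y in P :\: X | h i y].
have cO : P :\: X \subset \bigcup_(i in X) O i.
  apply/subsetP => y; rewrite inE => /andP[yX yP].
  have [x xP hyx] := nbr _ yP.
  have := vertex_coverP Xcov yP xP hyx; rewrite (negPf yX) /= => xX.
  by apply/bigcupP; exists x => //; rewrite !inE yX yP h_sym.
(* I is a minimal subset of X whose neighbourhoods cover P :\: X, so each of its
   elements has a private neighbour outside X. *)
have [I minI IX] := @minset_exists _
  (fun I : {set V} => P :\: X \subset \bigcup_(i in I) O i) X cO.
have [cI Imin] := minsetP minI.
have priv : {in I, forall l, exists2 d, d \in O l & {in I, forall l', d \in O l' -> l' = l}}.
  move=> l lI; have : ~~ (P :\: X \subset \bigcup_(i in I :\ l) O i).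
    apply/negP => /Imin /(_ (subsetDl _ _)) E.
    by move: lI; rewrite -E !inE eqxx.
  case/subsetPn => d dO dn.
  have priv' : {in I, forall l', d \in O l' -> l' = l}.
    move=> l' l'I dl'; apply/eqP; apply/negPn/negP => nl.
    by case/negP: dn; apply/bigcupP; exists l' => //; rewrite !inE nl.
  exists d => //; have /bigcupP[l' l'I dl'] := subsetP cI _ dO.
  by rewrite -(priv' _ l'I dl').
have covI i : i \in I -> exists2 K, vertex_cover K & (i \notin K) && (#|K| <= 4).
  by move=> iI; apply: cov; apply: (subsetP XP); apply: (subsetP IX).
have Pcard : #|P| = #|X| + #|P :\: X| by rewrite (cardsD P X) (setIidPr XP) subnKC ?subset_leq_card.
have IXc : #|I| <= #|X| by apply: subset_leq_card.
have Osmall i : i \in I -> #|O i| + #|I| <= 5.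
  move=> iI; have [K Kc /andP[iK K4]] := covI i iI.
  have := leq_card_avoiding_cover Xcov IX iI Kc iK priv.
  have := subset_leq_card (subsetIl K (I :|: (P :\: X))); rewrite -/(O i).
  by move: K4; clear; lia.
have bU (J : {set V}) (F : V -> {set V}) k : (forall i, i \in J -> #|F i| <= k) ->
    #|\bigcup_(i in J) F i| <= #|J| * k.
  move=> Fk; rewrite -sum_nat_const.
  apply: (@leq_trans (\sum_(i in J) #|F i|)); last exact: leq_sum.
  elim/big_rec2: _ => [|i m A _ le]; first by rewrite cards0.
  by rewrite cardsU; lia.
have outI : #|P :\: X| <= #|I| * (5 - #|I|).
  apply: leq_trans (subset_leq_card cI) (bU _ _ _ _) => i /Osmall; lia.
have I4 : #|I| <= 4 := leq_trans IXc X4.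
have out_le6 : #|P :\: X| <= 6.
  by move: outI I4; case: #|I| => [|[|[|[|[|]]]]] //; lia.
have out6 : 6 <= #|P :\: X| by lia.
have I23 : (#|I| == 2) || (#|I| == 3).
  by move: outI I4; case: #|I| => [|[|[|[|[|]]]]] //; lia.
(* The other neighbourhoods account for at most (m - 1)(5 - m) of the 6 elements, where m = [#|I|];
   for m = 2 and m = 3 exactly 5 - m remain. *)
have Olarge i : i \in I -> 5 - #|I| <= #|O i|.
  move=> iI; have : #|P :\: X| <= #|O i| + #|I :\ i| * (5 - #|I|).
    apply: leq_trans (subset_leq_card cI) _.
    rewrite (big_setD1 i) //=; apply: leq_trans (leq_card_setU _ _) _.
    by rewrite leq_add2l; apply: bU => l /setD1P[_ /Osmall]; lia.
  have := cardsD1 i I; rewrite iI /=.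
  by move: out6; case/orP: I23 => /eqP ->; clear; lia.
have [w wX wI] : exists2 w, w \in X & w \notin I.
  by apply/subsetPn; apply/negP => /subset_leq_card; lia.
have [u uP hwu] := nbr _ (subsetP XP _ wX).
(* A cover avoiding i in I is the union of O i and I :\ i, so it misses w and
   must contain u; hence u lies in every O i, which leaves too few vertices. *)
have uO i : i \in I -> (u != i) && ((u \in I) || (u \in O i)).
  move=> iI; have [K Kc /andP[iK K4]] := covI i iI.
  have le := leq_card_avoiding_cover Xcov IX iI Kc iK priv.
  (* [le] and [Olarge] give this intersection at least 4 elements, and [K] has no more. *)
  have KE : K :&: (I :|: (P :\: X)) = K.
    apply/eqP; rewrite eqEcard subsetIl /=.
    apply: leq_trans K4 _; rewrite -ltnS; apply: leq_trans le.
    by rewrite addnC -leq_subLR; exact: Olarge.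
  have OK l : l \in I -> l \notin K -> O l \subset K :&: (P :\: X).
    move=> lI lK; apply/subsetP => d dO; rewrite inE.
    move: (dO); rewrite inE => /andP[dPX hld]; rewrite dPX andbT.
    have dP : d \in P by move: dPX; rewrite inE => /andP[].
    have := vertex_coverP Kc (subsetP XP _ (subsetP IX _ lI)) dP hld.
    by rewrite (negPf lK).
  have Kc4 : #|K :&: I| + #|K :&: (P :\: X)| <= 4.
    apply: leq_trans K4; rewrite -[in X in _ <= X]KE setIUr cardsU.
    rewrite (_ : _ :&: _ :&: _ = set0) ?cards0 ?subn0 //.
    apply/setP => x; rewrite !inE; case xI: (x \in I); rewrite ?andbF //.
    by rewrite (subsetP IX _ xI) /= !andbF.
  have out : #|P :\: X| <= #|K :&: (P :\: X)| + #|K :&: I| * (5 - #|I|).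
    have sub : P :\: X \subset (K :&: (P :\: X)) :|: \bigcup_(l in K :&: I) O l.
      apply/subsetP => d /(subsetP cI)/bigcupP[l lI dl]; rewrite inE.
      case lK: (l \in K); last by rewrite (subsetP (OK l lI _)) ?lK.
      by apply/orP; right; apply/bigcupP; exists l; rewrite // inE lK.
    apply: leq_trans (subset_leq_card sub) _.
    apply: leq_trans (leq_card_setU _ _) _.
    rewrite leq_add2l; apply: bU => l /setIP[_ /Osmall].
    by clear; lia.
  have KI : K :&: I \subset I :\ i.
    by apply/subsetP => l /setIP[lK lI]; rewrite !inE lI andbT; apply: contraNneq iK => <-.
  have {KI} KIc := subset_leq_card KI.
  have Ii : #|I| = #|I :\ i|.+1 by rewrite (cardsD1 i I) iI.
  (* The bounds force [K] to contain all of [I] except [i]. This leaves [K] at most [5 - #|I|]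
     elements outside [X], which [O i] already fills. *)
  have OE : O i = K :&: (P :\: X).
    apply/eqP; rewrite eqEcard OK //=.
    move: (Olarge i iI) Kc4 out out6 KIc Ii; case/orP: I23 => /eqP ->; clear; lia.
  have uK : u \in K.
    have := vertex_coverP Kc (subsetP XP _ wX) uP hwu.
    by rewrite -{1}KE !inE (negPf wI) wX andbF /=.
  apply/andP; split; first by apply: contraNneq iK => <-.
  by move: uK; rewrite -{1}KE OE !inE; case: (u \in I) => //=; case: (u \in K).
have uI : u \notin I by apply/negP => /uO; rewrite eqxx.
have [i0 i0I] : exists i, i \in I by apply/card_gt0P; lia.
have sub : P :\: X \subset u |: \bigcup_(i in I) (O i :\ u).
  apply/subsetP => d /(subsetP cI)/bigcupP[l lI dl]; rewrite !inE.
  case: eqP => //= du; apply/bigcupP; exists l => //.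
  by rewrite 2!inE dl andbT; apply/eqP.
(* Counting the common element [u] once leaves at most 1 + m(4 - m) elements outside [X]: 5 for m =
   2 and 4 for m = 3, against the required 6. *)
have := subset_leq_card sub; rewrite cardsU1.
have : #|\bigcup_(i in I) (O i :\ u)| <= #|I| * (4 - #|I|).
  apply: bU => i iI; have := Osmall i iI.
  by have /andP[_] := uO i iI; rewrite (negPf uI) /= (cardsD1 u (O i)) => ->; clear; lia.
by move: out6; case/orP: I23 => /eqP ->; case: (_ \notin _) => /=; clear; lia.
Qed.

End VertexCovers.

(** * Coloured cubic graphs *)

Definition sees (T : finType) (e : rel T) (c : T -> nat) (x : T) (k : nat) : bool :=
  [exists y, ((y == x) || e x y) && (c y == k)].

(* The colour classes B_i = i, C_i = 3 + i, D_i = 6 + i (i < 3) form the coalition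
   partition, in which B_i is a partner of both C_i and D_i. *)
Record coloured_graph (T : finType) (e : rel T) (c : T -> nat) (u v : T) : Prop :=
  ColouredGraph {
    cg_sym : symmetric e;
    cg_irr : irreflexive e;
    cg_connect : forall x y, connect e x y;
    cg_regular : regular_graph e 3;
    cg_edge : e u v;
    cg_colour_u : c u = 1;
    cg_colour_v : c v = 2;
    cg_colour_lt9 : forall x, c x < 9;
    cg_colour_onto : forall k, k < 9 -> exists x, c x = k;
    cg_dominated : forall x k, k < 3 ->
      sees e c x k || (sees e c x (3 + k) && sees e c x (6 + k));
    cg_missed : forall k, k < 9 -> exists x, ~~ sees e c x k
  }.

Lemma connect_homo (T T' : finType) (e : rel T) (e' : rel T') (f : T -> T') :
    (forall x y, e x y -> connect e' (f x) (f y)) ->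
  forall x y, connect e x y -> connect e' (f x) (f y).
Proof.
move=> fe x _ /connectP[p ep ->]; elim: p x ep => [|z p IHp] x /=.
  by move=> _; exact: connect0.
by case/andP=> /fe exz /IHp; exact: connect_trans.
Qed.

(** In this form a degree can be split over a sum type and reindexed along a bijection. *)
Lemma degree_sum (T : finType) (e : rel T) x : degree e x = \sum_y e x y.
Proof. by rewrite /degree -sum1dep_card big_mkcond; apply: eq_bigr => y _; case: (e x y). Qed.

(** * Insertion of a diamond into an edge *)

Section Diamond.
Variables (T : finType) (e : rel T) (c : T -> nat) (u v : T).
Hypothesis G : coloured_graph e c u v.

Let T' : finType := (T + bool * bool)%type.

Let cut (x y : T) : bool := (x == u) && (y == v) || (x == v) && (y == u).

Let spoke (x : T) (p : bool * bool) : bool := p.1 && (x == if p.2 then u else v).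

(* The edge uv is replaced by a copy of K_4 minus the edge from (true, true) to
   (true, false), with these two vertices attached to u and v respectively. *)
Let e' : rel T' := fun x y =>
  match x, y with
  | inl x, inl y => e x y && ~~ cut x y
  | inl x, inr p | inr p, inl x => spoke x p
  | inr p, inr q => (p != q) && ~~ (p.1 && q.1)
  end.

(* The diamond vertex next to u repeats the colour of v and conversely. *)
Let c' (x : T') : nat :=
  match x with
  | inl x => c x
  | inr p => if p.1 then (if p.2 then 2 else 1) else 0
  end.

Let uv : u != v.
Proof. by apply: contraTneq (cg_edge G) => ->; rewrite (cg_irr G). Qed.

Let e'_sym : symmetric e'.
Proof.
move=> [x|p] [y|q] //=.
  by rewrite (cg_sym G) /cut orbC; congr (_ && ~~ (_ || _)); rewrite andbC.
by rewrite eq_sym andbC [q.1 && _]andbC andbC.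
Qed.

Let e'_irr : irreflexive e'.
Proof. by move=> [x|p] /=; rewrite ?(cg_irr G) ?eqxx. Qed.

Let e'_regular : regular_graph e' 3.
Proof.
have sum_bb (F : bool * bool -> nat) :
    \sum_p F p = F (true, true) + F (true, false) + F (false, true) + F (false, false).
  rewrite (eq_bigr (fun p => F (p.1, p.2))) => [|[] //].
  by rewrite -(pair_bigA _ (fun h s => F (h, s))) /= !big_bool /= addnA.
have sum_eq (z : T) : \sum_y (y == z) = 1.
  by rewrite (bigD1 z) //= eqxx big1 // => i /negPf->.
move=> [x|p]; rewrite degree_sum big_sumType /= sum_bb /=.
  (* Cutting [uv] costs [u] and [v] one neighbour each, and the spokes give it back. *)
  have : \sum_y e x y = \sum_y (e x y && ~~ cut x y) + \sum_y cut x y.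
    rewrite -big_split /=; apply: eq_bigr => y _.
    case cxy: (cut x y); rewrite ?andbT ?addn0 // andbF.
    case/orP: cxy => /andP[/eqP-> /eqP->]; first by rewrite (cg_edge G).
    by rewrite (cg_sym G) (cg_edge G).
  rewrite -degree_sum (cg_regular G) => ->.
  have -> : \sum_y cut x y = (x == u) + (x == v).
    rewrite /cut; case: (eqVneq x u) => [->|_] /=.
      by rewrite (negPf uv) /= -[RHS](sum_eq v); apply: eq_bigr => y _; rewrite orbF.
    case: (x == v) => /=; first exact: sum_eq.
    by rewrite big1.
  by rewrite /spoke /= !addn0 addnA.
by case: p => [[] []]; rewrite /spoke /= ?sum_eq ?big1.
Qed.

Let e'_connect x y : connect e' x y.
Proof.
have csym : connect_sym e' by exact: sym_connect_sym.
have K p q : connect e' (inr p) (inr q).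
  have to0 r : connect e' (inr (false, false)) (inr r).
    by case: r => [[] []]; rewrite ?connect0 // connect1.
  by apply: connect_trans (to0 q); rewrite csym.
have cu : connect e' (inl u) (inr (true, true)).
  by apply: connect1; rewrite /= /spoke /= eqxx.
have cv : connect e' (inl v) (inr (true, true)).
  apply: (@connect_trans _ _ (inr (true, false))); last exact: K.
  by apply: connect1; rewrite /= /spoke /= eqxx.
have cuv : connect e' (inl u) (inl v) by apply: connect_trans cu _; rewrite csym.
have L (z t : T) : connect e' (inl z) (inl t).
  apply: (@connect_homo _ _ e) (cg_connect G z t) => {}z {}t ezt.
  case czt: (cut z t); last by apply: connect1; rewrite /= ezt czt.
  by case/orP: czt => /andP[/eqP-> /eqP->] //; rewrite csym.
have toK z : connect e' z (inr (true, true)).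
  by case: z => [z|p] //; apply: connect_trans cu.
by apply: connect_trans (toK x) _; rewrite csym.
Qed.

(** Only [u] and [v] change neighbours: [u] exchanges [v] for a diamond vertex of the colour of [v],
    and symmetrically. *)
Let sees_inl x k : sees e' c' (inl x) k = sees e c x k.
Proof.
apply/existsP/existsP => [[[y|p]] /= /andP[h ck]|[y /andP[h ck]]].
- exists y; rewrite ck andbT; case/orP: h => [/eqP[->]|/andP[-> _]]; rewrite ?eqxx ?orbT //.
- move: h ck; rewrite /spoke; case: p => [[] []] //= /eqP-> /eqP <-.
    by exists v; rewrite (cg_edge G) orbT (cg_colour_v G).
  by exists u; rewrite (cg_sym G) (cg_edge G) orbT (cg_colour_u G).
- case cxy: (cut x y); last first.
    by exists (inl y); rewrite /= ck cxy andbT; case/orP: h => [/eqP->|->]; rewrite ?eqxx ?orbT.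
  case/orP: cxy ck => /andP[/eqP-> /eqP->] /eqP <-.
    by exists (inr (true, true)); rewrite /= /spoke /= eqxx (cg_colour_v G).
  by exists (inr (true, false)); rewrite /= /spoke /= eqxx (cg_colour_u G).
Qed.

(** Every diamond vertex sees all three classes B_i, so it needs no C_i or D_i nearby. *)
Let sees_inr p k : k < 3 -> sees e' c' (inr p) k.
Proof.
case: k => [|[|[|//]]] _; apply/existsP.
- by exists (inr (false, true)); case: p => [[] []].
- case: p => [[] s]; last by exists (inr (true, false)).
  case: s; last by exists (inr (true, false)).
  by exists (inl u); rewrite /= /spoke /= (cg_colour_u G) eqxx.
case: p => [[] s]; last by exists (inr (true, true)).
case: s; first by exists (inr (true, true)).
by exists (inl v); rewrite /= /spoke /= (cg_colour_v G) eqxx.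
Qed.

Lemma diamond_insertion :
  exists (e1 : rel T') (c1 : T' -> nat) (u1 v1 : T'), coloured_graph e1 c1 u1 v1.
Proof.
(* The edge from [u] to its new neighbour again joins colours 1 and 2, so insertion can be
   repeated. *)
exists e', c', (inl u), (inr (true, true)); split=> //=.
- by rewrite /spoke /= eqxx.
- exact: cg_colour_u G.
- by move=> [x|[[] []]] //=; apply: cg_colour_lt9 G _.
- by move=> k /(cg_colour_onto G)[x cx]; exists (inl x).
- move=> [x|p] k k3; last by rewrite sees_inr.
  by rewrite !sees_inl; apply: cg_dominated G _ _ k3.
- by move=> k /(cg_missed G)[x xk]; exists (inl x); rewrite sees_inl.
Qed.

End Diamond.

(** This brings the sum type produced by an insertion back to an ordinal type. *)
Lemma coloured_graph_transport (T T' : finType) (e : rel T) (c : T -> nat) (u v : T)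
    (f : T' -> T) (g : T -> T') : cancel f g -> cancel g f -> coloured_graph e c u v ->
  coloured_graph (relpre f e) (c \o f) (g u) (g v).
Proof.
move=> fK gK G.
have se x k : sees (relpre f e) (c \o f) x k = sees e c (f x) k.
  apply/existsP/existsP => [[y]|[y]] /=; first by rewrite -(can_eq fK); exists (f y).
  by exists (g y); rewrite /= -(can_eq fK) gK.
split; rewrite /= ?gK.
- by move=> x y; exact: (cg_sym G).
- by move=> x; exact: (cg_irr G).
- move=> x y; rewrite -[x]fK -[y]fK; apply: (@connect_homo _ _ e) (cg_connect G _ _).
  by move=> z t ezt; apply: connect1; rewrite /= !gK.
- move=> x; rewrite -(cg_regular G (f x)) !degree_sum /=.
  by rewrite [RHS](reindex f) //; exists g => y _.
- exact: cg_edge G.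
- exact: cg_colour_u G.
- exact: cg_colour_v G.
- by move=> x; exact: (cg_colour_lt9 G).
- by move=> k /(cg_colour_onto G)[x cx]; exists (g x); rewrite gK.
- by move=> x k k3; rewrite !se; exact: (cg_dominated G).
- by move=> k /(cg_missed G)[x xk]; exists (g x); rewrite se gK.
Qed.

(** * The coalition number: upper bound for cubic graphs, exact value for coloured graphs *)

Lemma coalition_sym (T : finType) (e : rel T) : symmetric (coalition e).
Proof.
move=> A B; rewrite /coalition disjoint_sym setUC.
by case: dominating; rewrite ?andbF //= andbC.
Qed.

Section Regular.
Variables (T : finType) (e : rel T).
Hypotheses (e_reg : regular_graph e 3) (T4 : 4 < #|T|).

Lemma not_full_singleton A : ~~ full_singleton e A.
Proof. by apply/existsP => -[x /andP[_]]; rewrite e_reg; lia. Qed.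

Lemma coalition_partition_le9 P : coalition_partition e P -> #|P| <= 9.
Proof.
case/andP=> /and3P[/eqP covP triP _] /forall_inP coalP.
have partner A : A \in P -> ~~ dominating e A /\ exists2 B, B \in P & coalition e A B.
  move=> /coalP; rewrite (negPf (not_full_singleton A)) andbF /=.
  by case/andP=> nd /existsP[B /andP[/setD1P[_ BP] AB]]; split=> //; exists B.
apply: (@card_le9_of_small_covers _ (coalition e)); first exact: coalition_sym.
  by move=> A /partner[].
move=> A AP; have [+ _] := partner A AP.
(* The blocks meeting the closed neighbourhood of a vertex not dominated by A. *)
rewrite negb_forall_in => /exists_inP[x xA /exists_inPn nx].
pose N := x |: [set y | e x y].
have meetN B C : coalition e B C -> B \in P -> C \in P ->
    exists2 y, y \in N & (y \in B) || (y \in C).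
  case/and4P=> _ _ _ /forall_inP dBC _ _.
  case xBC: (x \in B :|: C); first by exists x; rewrite ?setU11 -?in_setU.
  have /exists_inP[y yBC exy] : [exists y in B :|: C, e x y].
    by apply: dBC; rewrite inE xBC.
  by exists y; rewrite -?in_setU // !inE exy orbT.
exists (pblock P @: N).
  apply/andP; split.
    by apply/subsetP => _ /imsetP[y _ ->]; rewrite pblock_mem // covP inE.
  apply/forall_inP => B BP; apply/forall_inP => C CP; apply/implyP => BC.
  have [y yN /orP[yB|yC]] := meetN _ _ BC BP CP; apply/orP; [left|right].
    by rewrite -(def_pblock triP BP yB) imset_f.
  by rewrite -(def_pblock triP CP yC) imset_f.
apply/andP; split.
  (* [A] is not in this cover: it does not dominate [x], so it is disjoint from [N]. *)
  apply/imsetP => -[y yN AE].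
  have yA : y \in A by rewrite AE mem_pblock covP inE.
  move: yN; rewrite !inE => /orP[/eqP yx|exy]; first by move: xA; rewrite inE -yx yA.
  by have := nx y yA; rewrite exy.
apply: leq_trans (leq_imset_card _ _) _.
by rewrite cardsU1 -/(degree e x) e_reg; case: (_ \notin _).
Qed.

End Regular.

Lemma coalition_number_coloured (T : finType) (e : rel T) (c : T -> nat) (u v : T) :
  4 < #|T| -> coloured_graph e c u v -> coalition_number e = 9.
Proof.
move=> T4 G; apply/eqP; rewrite eqn_leq; apply/andP; split.
  apply/bigmax_leqP => P; apply: coalition_partition_le9 => //; exact: cg_regular G.
pose cl (k : nat) := [set x | c x == k].
pose P := [set cl k | k : 'I_9].
have cl_inj k l : k < 9 -> cl k = cl l -> k = l.
  move=> /(cg_colour_onto G)[x cx] /setP/(_ x); rewrite !inE cx eqxx.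
  by move=> /esym/eqP.
have domE A : dominating e A = [forall x, exists y in A, (y == x) || e x y].
  apply/forall_inP/forallP => [h x|h x xA].
    case xA: (x \in A); first by apply/exists_inP; exists x; rewrite ?eqxx.
    have /exists_inP[y yA exy] : [exists y in A, e x y] by apply: h; rewrite inE xA.
    by apply/exists_inP; exists y; rewrite ?exy ?orbT.
  have /exists_inP[y yA /orP[/eqP yx|exy]] := h x; apply/exists_inP; exists y => //.
  by move: xA; rewrite inE -yx yA.
have nd k : k < 9 -> ~~ dominating e (cl k).
  move=> /(cg_missed G)[x nx]; rewrite domE; apply/forallP => /(_ x)/exists_inP[y].
  by rewrite inE => ck exy; case/existsP: nx; exists y; rewrite exy.
have coal k l : k < 3 -> (l == 3 + k) || (l == 6 + k) -> coalition e (cl k) (cl l).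
  move=> k3 lk; rewrite /coalition !nd; [|by lia..].
  apply/and4P; split=> //.
    rewrite disjoint_subset; apply/subsetP => x; rewrite !inE => /eqP->.
    by clear -k3 lk; lia.
  rewrite domE; apply/forallP => x; apply/exists_inP.
  have := cg_dominated G x k3.
  case/orP=> [/existsP[y /andP[h ck]]|/andP[/existsP[y /andP[h cy]] /existsP[z /andP[h' cz]]]].
    by exists y => //; rewrite !inE ck.
  case/orP: lk => /eqP->; first by exists y; rewrite // !inE cy orbT.
  by exists z; rewrite // !inE cz orbT.
have clP k : k < 9 -> cl k \in P by move=> k9; apply/imsetP; exists (Ordinal k9).
have cardP : #|P| = 9.
  rewrite card_imset ?card_ord // => i j /cl_inj E; apply: val_inj; exact: E.
rewrite -{1}cardP; apply: (@leq_bigmax_cond _ (coalition_partition e) (fun Q => #|Q|)).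
apply/andP; split.
  apply/and3P; split.
  - rewrite eqEsubset subsetT /=; apply/subsetP => x _; apply/bigcupP.
    by exists (cl (c x)); rewrite ?inE // clP // (cg_colour_lt9 G).
  - apply/trivIsetP => _ _ /imsetP[i _ ->] /imsetP[j _ ->] nij.
    rewrite disjoint_subset; apply/subsetP => x; rewrite !inE => /eqP cx.
    by apply: contraNN nij; rewrite cx => /eqP ->.
  - apply/imsetP => -[i _ /setP E]; have [x cx] := cg_colour_onto G (ltn_ord i).
    by have := E x; rewrite !inE cx eqxx.
apply/forall_inP => _ /imsetP[[k k9] _ ->] /=; rewrite (nd k k9) orbC /=; apply/orP; left.
have fin l : l < 9 -> coalition e (cl k) (cl l) ->
    [exists B in P :\ cl k, coalition e (cl k) B].
  move=> l9 h; apply/exists_inP; exists (cl l) => //.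
  rewrite !inE clP // andbT; apply: contraTneq h => ->.
  by rewrite /coalition -setI_eq0 setIid; have [x cx] := cg_colour_onto G k9;
    rewrite (_ : cl k == set0 = false) //; apply/eqP => /setP/(_ x); rewrite !inE cx eqxx.
case: (ltnP k 3) => k3; first by apply: (fin (3 + k)); [lia | apply: coal; rewrite ?eqxx].
(* C_i and D_i have colours 3 + i and 6 + i, both congruent modulo 3 to the colour of their partner
   B_i. *)
apply: (fin (k %% 3)); first lia.
by rewrite coalition_sym coal //; lia.
Qed.

(** * Base graphs, verified by computation *)

Section HamiltonianCubic.
Variables (n : nat) (chord colour : seq nat).

(* Vertex x of the cycle 0, 1, ..., n - 1 is also joined to the x-th entry of chord. *)
Definition chord_nbrs (x : nat) : seq nat :=
  [:: x.+1 %% n; (x + n.-1) %% n; nth 0 chord x].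

Definition sees_nbrs (x k : nat) : bool :=
  has (fun y => nth 0 colour y == k) (x :: chord_nbrs x).

(** The [uniq] test yields both irreflexivity and degree 3. Requiring a smaller neighbour at each
    nonzero vertex yields connectedness, by descent to 0. *)
Definition base_check (u v : nat) : bool :=
  [&& all (fun x => [&& uniq (x :: chord_nbrs x), all (fun y => y < n) (chord_nbrs x),
        all (fun y => x \in chord_nbrs y) (chord_nbrs x),
        (x == 0) || has (fun y => y < x) (chord_nbrs x),
        nth 0 colour x < 9 &
        all (fun k => sees_nbrs x k || (sees_nbrs x (3 + k) && sees_nbrs x (6 + k)))
          (iota 0 3)]) (iota 0 n),
    all (fun k => has (fun x => nth 0 colour x == k) (iota 0 n)
               && has (fun x => ~~ sees_nbrs x k) (iota 0 n)) (iota 0 9),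
    u < n, v < n, v \in chord_nbrs u, nth 0 colour u == 1 & nth 0 colour v == 2].

Lemma coloured_graph_of_chords u v : base_check u v ->
  exists (e : rel 'I_n) (c : 'I_n -> nat) (u1 v1 : 'I_n), coloured_graph e c u1 v1.
Proof.
case/and3P=> /allP vert /allP cols /and5P[un vn uv cu cv].
pose e : rel 'I_n := fun x y => val y \in chord_nbrs x.
pose c (x : 'I_n) := nth 0 colour x.
have vertP (x : 'I_n) : _ := vert x (etrans (mem_iota 0 n x) (ltn_ord x)).
have e_sub (x y : 'I_n) : e x y -> e y x.
  by have /and5P[_ _ /allP h _ _] := vertP x; apply: h.
have e_symm : symmetric e by move=> x y; apply/idP/idP; apply: e_sub.
have seesE x k : sees e c x k = sees_nbrs x k.
  apply/existsP/hasP => [[y /andP[h ck]]|[y h ck]].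
    by exists (val y); rewrite // inE.
  have yn : y < n.
    have /and5P[_ /allP h2 _ _ _] := vertP x.
    by move: h; rewrite inE => /orP[/eqP->|/h2].
  by exists (Ordinal yn); rewrite /e /c /= ck andbT -val_eqE /= -in_cons.
exists e, c, (Ordinal un), (Ordinal vn); split=> //.
- by move=> x; have /and5P[/andP[/negPf]] := vertP x.
- have n0 : 0 < n by lia.
  have to0 m (mn : m < n) : connect e (Ordinal mn) (Ordinal n0).
    elim/ltn_ind: m mn => m IH mn; have /and5P[_ /allP lt_n _ + _] := vertP (Ordinal mn).
    case/orP=> [/eqP /= m0|/hasP[y ym /= lym]].
      by rewrite (_ : Ordinal mn = Ordinal n0) //; apply: val_inj.
    apply: connect_trans (IH y lym (lt_n y ym)); exact: connect1.
  move=> [x xn] [y yn]; apply: connect_trans (to0 x xn) _.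
  by rewrite (sym_connect_sym e_symm).
- move=> x; have /and5P[/andP[_ un3] /allP lt_n _ _ _] := vertP x.
  rewrite /degree -[RHS]/(size (chord_nbrs x)) cardE.
  rewrite -(size_map val); apply/perm_size/uniq_perm => //.
    by rewrite (map_inj_uniq val_inj) enum_uniq.
  move=> y; apply/mapP/idP => [[z + ->]|yx]; first by rewrite mem_enum inE.
  by exists (Ordinal (lt_n y yx)); rewrite // mem_enum inE.
- exact/eqP.
- exact/eqP.
- by move=> x; have /and5P[_ _ _ _ /andP[]] := vertP x.
- move=> k k9; have /andP[/hasP[x + /eqP cx] _] := cols k (etrans (mem_iota 0 9 k) k9).
  by rewrite mem_iota => xn; exists (Ordinal xn).
- move=> x k k3; rewrite !seesE; have /and5P[_ _ _ _ /andP[_ /allP]] := vertP x.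
  by apply; rewrite mem_iota.
- move=> k k9; have /andP[_ /hasP[x + sx]] := cols k (etrans (mem_iota 0 9 k) k9).
  by rewrite mem_iota => xn; exists (Ordinal xn); rewrite seesE.
Qed.

End HamiltonianCubic.

(** * Induction on the order *)

Lemma coloured_graph_exists (n : nat) : ~~ odd n -> 16 <= n ->
  exists (e : rel 'I_n) (c : 'I_n -> nat) (u v : 'I_n), coloured_graph e c u v.
Proof.
elim/ltn_ind: n => n IH n_even n16.
have [n20|n20] := leqP 20 n; last first.
  (* An insertion adds 4 vertices, so each even residue modulo 4 needs a base graph. In both, the
     distinguished edge is the cycle edge between vertices 2 and 3. *)
  have /orP[/eqP->|/eqP->] : (n == 16) || (n == 18) by lia.
    by apply: (@coloured_graph_of_chords 16
      [:: 14; 15; 8; 5; 6; 3; 4; 13; 2; 11; 12; 9; 10; 7; 0; 1]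
      [:: 6; 2; 1; 2; 8; 0; 1; 5; 0; 2; 4; 7; 0; 2; 1; 3] 2 3).
  by apply: (@coloured_graph_of_chords 18
    [:: 14; 15; 4; 5; 2; 3; 8; 16; 6; 17; 12; 13; 10; 11; 0; 1; 7; 9]
    [:: 1; 0; 2; 1; 6; 3; 2; 0; 1; 0; 2; 4; 7; 0; 2; 1; 8; 5] 3 2).
have [||| e [c [u [v G]]]] := IH (n - 4); try lia.
have [e1 [c1 [u1 [v1 G1]]]] := diamond_insertion G.
have cardT : #|{: 'I_(n - 4) + bool * bool}| = n.
  by rewrite card_sum card_prod card_bool card_ord; lia.
do 4!eexists.
apply: (@coloured_graph_transport _ _ _ _ _ _
  (fun i : 'I_n => enum_val (cast_ord (esym cardT) i))
  (fun x => cast_ord cardT (enum_rank x)) _ _ G1) => x.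
  by rewrite enum_valK cast_ordKV.
by rewrite cast_ordK enum_rankK.
Qed.

Theorem proposition1 (n : nat) (n_even : ~~ odd n) (n_ge16 : 16 <= n) :
  exists e : rel 'I_n,
    [/\ simple_graph e, connected_graph e, regular_graph e 3
      & coalition_number e = 9].
Proof.
have [e [c [u [v G]]]] := coloured_graph_exists n_even n_ge16.
exists e; split.
- by split; [exact: cg_sym G | exact: cg_irr G].
- by split; [rewrite card_ord; lia | exact: cg_connect G].
- exact: cg_regular G.
- by apply: coalition_number_coloured G; rewrite card_ord; lia.
Qed.
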